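(* Let $n\in\mathbb{N}$, let $E$ be a nontrivial uniformly complete Archimedean real vector lattice, let $Y$ be a real separated convex bornological space, and suppose $T\colon E^n\to Y$ is a bounded $n$-linear map. Then the following are equivalent. (i) $T$ is orthosymmetric. (ii) $T(f_1,\dots,f_n)=0$ whenever $f_1,\dots,f_n\in E$ satisfy $\bigwedge_{k=1}^n|f_k|=0$. (iii) $T(f_1,\dots,f_n)=0$ whenever $f_1,\dots,f_n\in E^+$ satisfy $\bigwedge_{k=1}^n f_k=0$.
   Context: $\mathbb{N}$ is the set of strictly positive integers; nontrivial means $E\neq\{0\}$; $E^+$ is the positive cone of $E$. Uniformly complete means relatively uniformly complete: for every $u\in E^+$, every $u$-uniformly Cauchy sequence converges $u$-uniformly in $E$. A real convex bornological space is a real vector space $Y$ with a family of subsets (called bounded) that covers $Y$ and is closed under passing to subsets, finite unions, vector sums, multiplication by scalars, balanced hulls and convex hulls; it is separated if $\{0\}$ is the only bounded vector subspace. The vector lattice $E$ carries the bornology of order bounded sets, and a map $E^n\to Y$ is bounded if it maps products of order bounded subsets of $E$ to bounded subsets of $Y$. An $n$-linear map $T\colon E^n\to Y$ is orthosymmetric if $T(f_1,\dots,f_n)=0$ whenever $f_1,\dots,f_n\in E$ and $|f_i|\wedge|f_j|=0$ for some $i,j\in\{1,\dots,n\}$. *)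

(* Defs.v *)
From HB Require Import structures.
From mathcomp Require Import all_boot all_order all_algebra.
From mathcomp Require Import boolp classical_sets reals convex.

Set Implicit Arguments.
Unset Strict Implicit.
Unset Printing Implicit Defensive.

Import Order.TTheory GRing.Theory Num.Theory.

Local Open Scope classical_set_scope.
Local Open Scope ring_scope.

(* The meet and join are fields of the mixin, characterized as greatest lower
   and least upper bounds, rather than inherited from [Order.Lattice]: no
   structure can join [Order.Lattice] and [GRing.Zmodule] below the already
   declared [Num.RealDomain]. *)
HB.mixin Record isVectorLattice (R : numDomainType) E
    of GRing.Lmodule R E & Order.POrder ring_display E := {
  vlat_leD2r : forall x y z : E, x <= y -> x + z <= y + z;
  vlat_scale_ge0 : forall (a : R) (x : E), 0 <= a -> 0 <= x -> 0 <= a *: x;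
  vmeet : E -> E -> E;
  vjoin : E -> E -> E;
  le_vmeet : forall x y z : E, (z <= vmeet x y) = (z <= x) && (z <= y);
  vjoin_le : forall x y z : E, (vjoin x y <= z) = (x <= z) && (y <= z)
}.

#[short(type="vectorLatticeType")]
HB.structure Definition VectorLattice (R : numDomainType) :=
  { E of GRing.Lmodule R E & Order.POrder ring_display E
       & isVectorLattice R E }.

Section VectorLatticeDefs.
Context {R : realType} {E : vectorLatticeType R}.

Definition vabs (x : E) : E := vjoin x (- x).

(* Taking [f ord0] as the starting value of the iteration is harmless, since the
   meet is idempotent; it avoids requiring a top element. *)
Definition finmeet {n} (f : 'I_n.+1 -> E) : E :=
  \big[vmeet/f ord0]_(k < n.+1) f k.

Definition order_bounded (A : set E) : Prop := has_lbound A /\ has_ubound A.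

Definition u_cauchy (u : E) (x : nat -> E) : Prop :=
  forall e : R, 0 < e -> exists N : nat, forall p q : nat,
    (N <= p)%N -> (N <= q)%N -> vabs (x p - x q) <= e *: u.

Definition u_cvg_to (u : E) (x : nat -> E) (l : E) : Prop :=
  forall e : R, 0 < e -> exists N : nat, forall p : nat,
    (N <= p)%N -> vabs (x p - l) <= e *: u.

End VectorLatticeDefs.

Definition nontrivial_vlat {R : realType} (E : vectorLatticeType R) : Prop :=
  exists x : E, x != 0.

Definition archimedean_vlat {R : realType} (E : vectorLatticeType R) : Prop :=
  forall x y : E, 0 <= x -> 0 <= y -> (forall k : nat, x *+ k <= y) -> x = 0.

Definition uniformly_complete {R : realType} (E : vectorLatticeType R) : Prop :=
  forall u : E, 0 <= u -> forall x : nat -> E,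
    u_cauchy u x -> exists l : E, u_cvg_to u x l.

Definition balanced_set {R : numDomainType} {Y : lmodType R} (A : set Y) :
    Prop :=
  forall (a : R) (x : Y), `|a| <= 1 -> A x -> A (a *: x).

Definition balanced_hull {R : numDomainType} {Y : lmodType R} (A : set Y) :
    set Y :=
  smallest balanced_set A.

Definition convex_hull {R : numDomainType} {Y : lmodType R} (A : set Y) :
    set Y :=
  smallest (@convex_set R Y) A.

HB.mixin Record isConvexBornological (R : numDomainType) Y
    of GRing.Lmodule R Y := {
  bornology : set (set Y);
  bornology_cover : \bigcup_(A in bornology) A = [set: Y];
  bornology_sub : forall A B : set Y, A `<=` B -> bornology B -> bornology A;
  bornologyU : forall A B : set Y,
    bornology A -> bornology B -> bornology (A `|` B);
  bornologyD : forall A B : set Y,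
    bornology A -> bornology B -> bornology [set x + y | x in A & y in B];
  bornologyZ : forall (a : R) (A : set Y),
    bornology A -> bornology [set a *: x | x in A];
  bornology_balanced_hull : forall A : set Y,
    bornology A -> bornology (balanced_hull A);
  bornology_convex_hull : forall A : set Y,
    bornology A -> bornology (convex_hull A)
}.

#[short(type="convexBornologicalType")]
HB.structure Definition ConvexBornological (R : numDomainType) :=
  { Y of GRing.Lmodule R Y & isConvexBornological R Y }.

(* [{0}] itself is always bounded, by [bornology_cover] and [bornology_sub]. *)
Definition separated {R : realType} (Y : convexBornologicalType R) : Prop :=
  forall V : set Y, GRing.submod_closed (mem V) -> bornology V -> V = [set 0].

Definition multilinear_map {R : realType} {E Y : lmodType R} {n : nat}
    (T : ('I_n -> E) -> Y) : Prop :=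
  forall (i : 'I_n) (f : 'I_n -> E), linear (fun x => T [eta f with i |-> x]).

Definition bounded_map {R : realType} {E : vectorLatticeType R}
    {Y : convexBornologicalType R} {n : nat} (T : ('I_n -> E) -> Y) : Prop :=
  forall B : 'I_n -> set E, (forall i, order_bounded (B i)) ->
    bornology (T @` [set f | forall i, B i (f i)]).

(* The indices [i] and [j] may coincide; in that case [f i = 0]. *)
Definition orthosymmetric {R : realType} {E : vectorLatticeType R}
    {Y : lmodType R} {n : nat} (T : ('I_n -> E) -> Y) : Prop :=
  forall f : 'I_n -> E,
    (exists i j : 'I_n, vmeet (vabs (f i)) (vabs (f j)) = 0) -> T f = 0.

(* Main.v *)
(* The substantial implication is that an orthosymmetric T vanishes on positive
   f_1, ..., f_n whose meet over some set S of indices is 0. Induct on |S|: for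
   i <> j in S and c >= 1, put a = (f_i - c f_j)^+ and b = (f_j - f_i / c)^+,
   which are disjoint. As 0 <= f_i - a <= c f_j, replacing f_i by f_i - a yields
   a family whose meet over S \ {j} is already 0, so T vanishes there and f_i
   may be replaced by a; by orthosymmetry f_j may then be replaced by f_j - b.
   Since 0 <= c (f_j - b) <= f_i, the vector c T(f) lies in a bounded set that
   does not depend on c, so T(f) spans a bounded line and T(f) = 0 by separation.
   Arbitrary signs are handled by splitting into positive and negative parts. *)
Require Import Defs.
From HB Require Import structures.
From mathcomp Require Import all_boot all_order all_algebra.
From mathcomp Require Import boolp classical_sets reals convex.
Local Open Scope ring_scope.

Set Implicit Arguments.
Unset Strict Implicit.
Unset Printing Implicit Defensive.

Import Order.TTheory GRing.Theory Num.Theory.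

(** * Order calculus, positive parts and finite meets in a vector lattice *)

Section VectorLatticeTheory.
Context {R : realType} {E : vectorLatticeType R}.
Implicit Types x y z : E.

Lemma vlat_subr_ge0 x y : (0 <= y - x) = (x <= y).
Proof.
apply/idP/idP => [/(vlat_leD2r _ _ x)|/(vlat_leD2r _ _ (- x))].
  by rewrite add0r subrK.
by rewrite subrr.
Qed.

Lemma vlat_lerBlDr x y z : (x - y <= z) = (x <= z + y).
Proof. by rewrite -[LHS]vlat_subr_ge0 opprB addrA vlat_subr_ge0. Qed.

Lemma vlat_gerBl x y : 0 <= y -> x - y <= x.
Proof. by rewrite -[_ <= x]vlat_subr_ge0 opprB subrKC. Qed.

Lemma vlat_ler_wpZ2l (a : R) x y : 0 <= a -> x <= y -> a *: x <= a *: y.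
Proof.
move=> a0; rewrite -vlat_subr_ge0 -[a *: x <= _]vlat_subr_ge0 -scalerBr.
exact: vlat_scale_ge0.
Qed.

Definition vpos x : E := vjoin x 0.

Lemma vpos_ge0 x : 0 <= vpos x.
Proof. by have := lexx (vpos x); rewrite {1}/vpos vjoin_le => /andP[]. Qed.

Lemma le_vpos x : x <= vpos x.
Proof. by have := lexx (vpos x); rewrite {1}/vpos vjoin_le => /andP[]. Qed.

Lemma vpos_le x y : (vpos x <= y) = (x <= y) && (0 <= y).
Proof. exact: vjoin_le. Qed.

Lemma vposBvposN x : vpos x - vpos (- x) = x.
Proof.
apply: le_anti; apply/andP; split.
  rewrite vlat_lerBlDr vpos_le addrC -vlat_lerBlDr subrr vpos_ge0 /=.
  by rewrite -[x in _ <= _ + x]opprK vlat_subr_ge0 le_vpos.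
rewrite -vlat_subr_ge0 addrAC vlat_subr_ge0 vpos_le vlat_subr_ge0 le_vpos.
by rewrite -vlat_lerBlDr subrr vpos_ge0.
Qed.

Lemma vabs_ge0 x : 0 <= vabs x.
Proof.
have := lexx (vabs x); rewrite {1}/vabs vjoin_le => /andP[xle Nxle].
have := vlat_leD2r _ _ (vabs x) xle; have := vlat_leD2r _ _ x Nxle.
rewrite addNr addrC => le1 le2.
have /(vlat_scale_ge0 (2^-1)) : 0 <= vabs x + vabs x by exact: le_trans le2.
rewrite -mulr2n -scaler_nat scalerA mulVf ?pnatr_eq0 // scale1r.
by apply; rewrite invr_ge0 ler0n.
Qed.

Lemma ge0_vabs x : 0 <= x -> vabs x = x.
Proof.
move=> x0; apply: le_anti; apply/andP; split.
  rewrite vjoin_le lexx /=; apply: (@le_trans _ _ 0) => //.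
  by rewrite -[_ <= 0]vlat_subr_ge0 sub0r opprK.
by have := lexx (vabs x); rewrite {1}/vabs vjoin_le => /andP[].
Qed.

Lemma vpos_le_vabs x : vpos x <= vabs x.
Proof.
rewrite vpos_le vabs_ge0 andbT.
by have := lexx (vabs x); rewrite {1}/vabs vjoin_le => /andP[].
Qed.

Lemma vposN_le_vabs x : vpos (- x) <= vabs x.
Proof.
rewrite vpos_le vabs_ge0 andbT.
by have := lexx (vabs x); rewrite {1}/vabs vjoin_le => /andP[].
Qed.

(** If [z] lies below both parts, then [vpos x - z] still dominates [0] and [x], since
    [vpos x - x = vpos (- x)]; minimality of [vpos x] forces [z <= 0]. *)
Lemma vpos_disjoint x : vmeet (vpos x) (vpos (- x)) = 0.
Proof.
apply: le_anti; apply/andP; split; last by rewrite le_vmeet !vpos_ge0.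
set z := vmeet _ _.
have := lexx z; rewrite {2}/z le_vmeet => /andP[zx zNx].
rewrite -[z <= 0]vlat_subr_ge0 -(addrK (vpos x) (0 - z)) vlat_subr_ge0.
rewrite sub0r addrC vpos_le vlat_subr_ge0 zx andbT.
by rewrite -vlat_subr_ge0 addrAC vlat_subr_ge0 -{2}[x]vposBvposN opprB subrKC.
Qed.

Lemma vmeet_eq0_le x y x' y' : 0 <= x' -> 0 <= y' -> x' <= x -> y' <= y ->
  vmeet x y = 0 -> vmeet x' y' = 0.
Proof.
move=> x'0 y'0 x'x y'y xy0; apply: le_anti; rewrite le_vmeet x'0 y'0 andbT.
have := lexx (vmeet x' y'); rewrite le_vmeet => /andP[zx' zy'].
by rewrite -xy0 le_vmeet (le_trans zx' x'x) (le_trans zy' y'y).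
Qed.

Lemma finmeet_le n (f : 'I_n.+1 -> E) k : finmeet f <= f k.
Proof.
have fold_le (s : seq 'I_n.+1) i :
    i \in s -> \big[vmeet/f ord0]_(j <- s) f j <= f i.
  elim: s => // j s IHs; rewrite inE big_cons => /orP iP.
  have := lexx (vmeet (f j) (\big[vmeet/f ord0]_(j <- s) f j)).
  rewrite le_vmeet => /andP[lej les].
  by case: iP => [/eqP ->//|/IHs]; exact: le_trans.
by apply: fold_le; rewrite mem_index_enum.
Qed.

Lemma le_finmeet n (f : 'I_n.+1 -> E) z :
  (forall k, z <= f k) -> z <= finmeet f.
Proof.
(* The starting value [f ord0] is itself above [z], so the base case is an instance of [zf]. *)
move=> zf; rewrite /finmeet; elim/big_ind: _ => // x y zx zy.
by rewrite le_vmeet zx.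
Qed.

End VectorLatticeTheory.

(** * A vanishing criterion in separated bornologies *)

Section Separated.
Context {R : realType} {Y : convexBornologicalType R}.

(** The balanced hull of [A] contains the whole line through [y], which is then a bounded
    subspace. *)
Lemma separated_eq0 (A : set Y) (y : Y) : separated Y -> bornology A ->
  (forall c : R, 1 <= c -> A (c *: y)) -> y = 0.
Proof.
move=> sepY bA Ay.
pose V : set Y := [set x | exists r : R, x = r *: y]%classic.
have VE : V = [set 0]%classic.
  apply: sepY.
    split => [|a u v]; rewrite ?inE /V /=.
      by exists 0; rewrite scale0r.
    move=> [r ->] [s ->]; exists (a * r + s).
    by rewrite scalerDl scalerA.
  apply: bornology_sub (bornology_balanced_hull A bA) => _ [r ->] B [balB AB].
  (* This maximum is at least 1, so its multiple of [y] is in [A], and at least the modulus of [r],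
     so balancedness brings it down to [r *: y]. *)
  have c1 : 1 <= Num.max 1 `|r| by rewrite le_max lexx.
  have c0 : 0 < Num.max 1 `|r| by exact: lt_le_trans c1.
  have -> : r *: y = (r / Num.max 1 `|r|) *: (Num.max 1 `|r| *: y).
    by rewrite scalerA divfK // gt_eqF.
  apply: balB; last by apply/AB/Ay.
  rewrite normrM normfV (gtr0_norm c0) ler_pdivrMr // mul1r.
  by rewrite le_max lexx orbT.
have : V y by exists 1; rewrite scale1r.
by rewrite VE.
Qed.

End Separated.

(** * Multilinear maps, one coordinate at a time *)

Section Multilinear.
Context {R : realType} {E Y : lmodType R} {n : nat} (T : ('I_n -> E) -> Y).
Hypothesis T_linear : multilinear_map T.
Implicit Types f : 'I_n -> E.

Lemma eta_with_id f i : ([eta f with i |-> f i] : _ -> _) = f.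
Proof. by apply/funext => k /=; case: eqP => [->|]. Qed.

Lemma multilinear_withD f i x y :
  T [eta f with i |-> x + y] = T [eta f with i |-> x] + T [eta f with i |-> y].
Proof. by have := T_linear i f 1 x y; rewrite !scale1r. Qed.

Lemma multilinear_with0 f i : T [eta f with i |-> 0] = 0.
Proof.
have := multilinear_withD f i 0 0; rewrite addr0 => /eqP.
by rewrite eq_sym -subr_eq0 addrK => /eqP.
Qed.

Lemma multilinear_withZ f i a x :
  T [eta f with i |-> a *: x] = a *: T [eta f with i |-> x].
Proof.
by have := T_linear i f a x 0; rewrite /= multilinear_with0 !addr0.
Qed.

Lemma multilinear_withB f i x y :
  T [eta f with i |-> x - y] = T [eta f with i |-> x] - T [eta f with i |-> y].
Proof. by rewrite multilinear_withD -scaleN1r multilinear_withZ scaleN1r. Qed.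

Lemma multilinear_eq0 f i : f i = 0 -> T f = 0.
Proof. by move=> fi0; rewrite -(eta_with_id f i) fi0 multilinear_with0. Qed.

End Multilinear.

(** * Reduction to positive arguments, and vanishing on disjoint families *)

Section Orthosymmetric.
Context {R : realType} {E : vectorLatticeType R}.

(** Expanding each [g k] into its positive and negative parts, both between [0] and [vabs (g k)],
    writes [T g] as a signed sum of values of [T] that vanish. *)
Lemma multilinear_vabs_eq0 {Y : lmodType R} n (T : ('I_n -> E) -> Y)
    (g : 'I_n -> E) : multilinear_map T ->
  (forall f, (forall k, 0 <= f k <= vabs (g k)) -> T f = 0) -> T g = 0.
Proof.
move=> T_linear T0.
(* Only the first [m] coordinates may still be unsplit; [m = n] admits [g], and [m = 0] is the
   hypothesis. *)
suff H m f : (forall k : 'I_n, (k < m)%N && (f k == g k) ||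
    (0 <= f k <= vabs (g k))) -> T f = 0.
  by apply: (H n) => k; rewrite ltn_ord eqxx.
elim: m f => [|m IHm] f fP; first by apply: T0 => k; have := fP k.
have [mn|nm] := ltnP m n; last first.
  apply: IHm => k; have := fP k.
  by rewrite ltnS (leq_trans (ltn_ord k) nm) (ltnW (leq_trans (ltn_ord k) nm)).
pose i := Ordinal mn.
have [fi|nfi] := boolP (0 <= f i <= vabs (g i)).
  apply: IHm => k; have := fP k.
  rewrite ltnS leq_eqVlt; have [ki|//] := eqVneq (k : nat) m.
  have -> : k = i by exact: val_inj.
  by move=> _; rewrite fi orbT.
have := fP i; rewrite (negbTE nfi) orbF => /andP[_ /eqP fi].
rewrite -(eta_with_id f i) fi -(vposBvposN (g i)) multilinear_withB //.
have part x : 0 <= x <= vabs (g i) -> T [eta f with i |-> x] = 0.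
  move=> xP; apply: IHm => k /=.
  have [->|ki] := eqVneq k i; first by rewrite xP orbT.
  have := fP k; rewrite ltnS leq_eqVlt.
  by rewrite (_ : (k == m :> nat) = false) //; apply/negbTE.
by rewrite !part ?subrr // vpos_ge0 ?vpos_le_vabs ?vposN_le_vabs.
Qed.

(** Disjointness over [S] is phrased through positive lower bounds, a form that passes directly to
    [S :\ j] in the induction. *)
Lemma orthosymmetric_disjoint_eq0 {Y : convexBornologicalType R} n
    (T : ('I_n -> E) -> Y) (S : {set 'I_n}) (f : 'I_n -> E) :
    separated Y -> multilinear_map T -> bounded_map T -> orthosymmetric T ->
    S != finset.set0 -> (forall k, 0 <= f k) ->
    (forall z, 0 <= z -> (forall k, k \in S -> z <= f k) -> z = 0) ->
  T f = 0.
Proof.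
move=> sepY T_linear T_bounded T_ortho.
have [m] := ubnP #|S|; elim: m => // m IHm in S f *; rewrite ltnS => Sm.
case/set0Pn => i iS f0 fS.
have [S0|/set0Pn[j]] := eqVneq (S :\ i)%SET finset.set0.
  apply: (multilinear_eq0 T_linear (i := i)); apply: fS => // k kS.
  have /setP/(_ k) := S0; rewrite !inE kS andbT => /negbFE/eqP ->.
  exact: lexx.
rewrite !inE => /andP[ji jS].
(* Slot [j] is bounded by [f i] because it will receive [c *: (f j - b)]; no bound mentions [c]. *)
pose B k : set E := [set x | 0 <= x <= if k == j then f i else f k]%classic.
have obB k : order_bounded (B k).
  by split; [exists 0|exists (if k == j then f i else f k)] => x /andP[].
apply: (separated_eq0 sepY (T_bounded B obB)) => c c1.
have c0 : 0 < c by exact: lt_le_trans c1.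
pose a := vpos (f i - c *: f j); pose b := vpos (f j - c^-1 *: f i).
have a_ge0 : 0 <= a by exact: vpos_ge0.
have b_ge0 : 0 <= b by exact: vpos_ge0.
have a_le : a <= f i.
  by rewrite vpos_le f0 andbT vlat_gerBl // vlat_scale_ge0 // ltW.
have b_le : b <= f j.
  by rewrite vpos_le f0 andbT vlat_gerBl // vlat_scale_ge0 // invr_ge0 ltW.
have fia : f i - a <= c *: f j.
  by rewrite vlat_lerBlDr addrC -vlat_lerBlDr le_vpos.
have fjb : f j - b <= c^-1 *: f i.
  by rewrite vlat_lerBlDr addrC -vlat_lerBlDr le_vpos.
(* [a] is the positive part of [f i - c *: f j], and [b] lies below its negative part because
   [c^-1 <= 1]. *)
have ab0 : vmeet a b = 0.
  apply: (vmeet_eq0_le a_ge0 b_ge0 (lexx _) _ (vpos_disjoint _)).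
  rewrite opprB vpos_le vpos_ge0 andbT.
  have -> : f j - c^-1 *: f i = c^-1 *: (c *: f j - f i).
    by rewrite scalerBr scalerA mulVf ?gt_eqF // scale1r.
  set w := c *: f j - f i.
  apply: (@le_trans _ _ (c^-1 *: vpos w)).
    by apply: vlat_ler_wpZ2l; rewrite ?invr_ge0 ?(ltW c0) ?le_vpos.
  rewrite -vlat_subr_ge0 -{1}[vpos w]scale1r -scalerBl.
  by apply: vlat_scale_ge0; rewrite ?vpos_ge0 // subr_ge0 invf_le1.
have Tfia : T [eta f with i |-> f i - a] = 0.
  apply: (IHm (S :\ j)%SET).
  - by apply: leq_trans Sm; rewrite [ltnRHS](cardsD1 j) jS.
  - by apply/set0Pn; exists i; rewrite !inE eq_sym ji.
  - by move=> k /=; case: eqP; rewrite ?vlat_subr_ge0.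
  move=> z z0 zS.
  have zi : z <= f i - a.
    by have := zS i; rewrite !inE eq_sym ji iS /= eqxx; apply.
  have cz0 : 0 <= c^-1 *: z by apply: vlat_scale_ge0 => //; rewrite invr_ge0 ltW.
  have czz : c^-1 *: z <= z.
    rewrite -vlat_subr_ge0 -{1}[z]scale1r -scalerBl.
    by apply: vlat_scale_ge0; rewrite // subr_ge0 invf_le1.
  (* Scaling by [c^-1] gives a lower bound over all of [S]: at [j] by [fia], elsewhere since
     [c^-1 *: z <= z]. *)
  suff /(congr1 (fun x => c *: x)) : c^-1 *: z = 0.
    by rewrite scaler0 scalerA mulfV ?gt_eqF // scale1r.
  apply: fS => // k kS.
  have [->|kj] := eqVneq k j.
    rewrite -[f j]scale1r -(@mulVf _ c) ?gt_eqF // -scalerA.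
    apply: vlat_ler_wpZ2l; first by rewrite invr_ge0 ltW.
    exact: le_trans fia.
  apply: (le_trans czz); have [->|ki] := eqVneq k i.
    exact: le_trans (vlat_gerBl _ a_ge0).
  by have := zS k; rewrite !inE kj kS /= (negbTE ki); apply.
pose g := [eta f with i |-> a].
have gj : g j = f j by rewrite /g /= (negbTE ji).
have Tgb : T [eta g with j |-> b] = 0.
  apply: T_ortho; exists i, j => /=.
  by rewrite !eqxx eq_sym (negbTE ji) !ge0_vabs.
have -> : T f = T [eta g with j |-> f j - b].
  rewrite multilinear_withB // Tgb subr0 -gj eta_with_id.
  rewrite -{1}(eta_with_id f i) -{1}(subrK a (f i)) multilinear_withD //.
  by rewrite Tfia add0r.
rewrite -multilinear_withZ //.
(* The scalar [c] is absorbed into slot [j], where [fjb] bounds the result by [f i]. *)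
exists [eta g with j |-> c *: (f j - b)] => // k; rewrite /B /=.
have [_|kj] := eqVneq k j; last first.
  by have [->|_] := eqVneq k i; rewrite ?a_ge0 ?a_le // f0 lexx.
rewrite vlat_scale_ge0 ?vlat_subr_ge0 ?(ltW c0) //=.
rewrite -[f i]scale1r -(@mulfV _ c) ?gt_eqF // -scalerA.
by apply: vlat_ler_wpZ2l fjb; exact: ltW.
Qed.

End Orthosymmetric.

Theorem corollary3p19 (R : realType) (n : nat) (E : vectorLatticeType R)
    (Y : convexBornologicalType R) (T : ('I_n.+1 -> E) -> Y)
    (E_nontrivial : nontrivial_vlat E)
    (E_archimedean : archimedean_vlat E)
    (E_complete : uniformly_complete E)
    (Y_separated : separated Y)
    (T_linear : multilinear_map T)
    (T_bounded : bounded_map T) :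
  [<-> orthosymmetric T;
       forall f : 'I_n.+1 -> E, finmeet (fun k => vabs (f k)) = 0 -> T f = 0;
       forall f : 'I_n.+1 -> E,
         (forall k, 0 <= f k) -> finmeet f = 0 -> T f = 0].
Proof.
tfae => [T_ortho f f0|T0 f f_ge0 f0|T0 f [i [j fij]]].
- apply: multilinear_vabs_eq0 => // h hP.
  apply: (orthosymmetric_disjoint_eq0 (S := [set: 'I_n.+1]%SET)) => //.
  + by apply/set0Pn; exists ord0; rewrite inE.
  + by move=> k; have /andP[] := hP k.
  (* A lower bound of [h] is also one of the moduli of [f], whose meet is [0]. *)
  move=> z z0 zh; apply: le_anti; rewrite z0 andbT -f0; apply: le_finmeet => k.
  by have /andP[_] := hP k; apply: le_trans; apply: zh; rewrite inE.
- apply: T0; rewrite -[RHS]f0; congr finmeet; apply/funext => k.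
  exact: ge0_vabs.
apply: multilinear_vabs_eq0 => // h hP.
have h0 k : 0 <= h k by have /andP[] := hP k.
have h_le k : h k <= vabs (f k) by have /andP[] := hP k.
apply: T0 => //; apply: le_anti; rewrite le_finmeet // andbT.
(* The full meet lies below the meet of coordinates [i] and [j], which is already [0]. *)
rewrite -(vmeet_eq0_le (h0 i) (h0 j) (h_le i) (h_le j) fij).
by rewrite le_vmeet !finmeet_le.
Qed.
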